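(* Let $\lambda>0$, $\gamma>0$ and sector-bound matrices $U_1,U_2,V_1$ be given, and let $\bar A,\bar F,\bar B_1,\bar B_2,\bar C_1,\bar C_2,\bar D_{12},\bar D_{21},U',V'$ be the matrices of the augmented system defined in the context (built from the model matrices and a given nominal controller $(K,L)$). Suppose there exist symmetric positive definite matrices $X_1,Y_1\in\mathbb{R}^{2n\times 2n}$ and matrices $\hat A_Q\in\mathbb{R}^{2n\times 2n}$, $\hat B_Q\in\mathbb{R}^{2n\times p}$, $\hat C_Q\in\mathbb{R}^{m\times 2n}$ such that $$\begin{bmatrix} X_1 & I\\ I & Y_1\end{bmatrix}>0$$ and $$\begin{bmatrix} -X_1 & -I & \bar A X_1+\bar B_2\hat C_Q & \bar A & \bar F & \bar B_1 & 0 & 0 & 0\\ * & -Y_1 & \hat A_Q & Y_1\bar A+\hat B_Q\bar C_2 & Y_1\bar F+\hat B_Q\bar D_{21} & Y_1\bar B_1 & 0 & 0 & 0\\ * & * & -X_1 & -I & 0 & 0 & X_1\bar C_1^T+\hat C_Q^T\bar D_{12}^T & X_1U'^T+\hat C_Q^TU_2^T & X_1V'^T\\ * & * & * & -Y_1 & 0 & 0 & \bar C_1^T & U'^T & V'^T\\ * & * & * & * & -\lambda^2 I & 0 & 0 & 0 & 0\\ * & * & * & * & * & -\gamma^2 I & 0 & 0 & 0\\ * & * & * & * & * & * & -I & 0 & 0\\ * & * & * & * & * & * & * & -\frac{1}{\lambda^2}I & 0\\ * & * & * & * & * & * & * & * & -\frac{1}{\lambda^2}I \end{bmatrix}<0,$$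 where $*$ denotes the blocks determined by symmetry. Let $X_2,Y_2\in\mathbb{R}^{2n\times 2n}$ be nonsingular matrices with $Y_1X_1+Y_2X_2^T=I$, and define the controller $Q$ (with $D_Q=0$) by $$\begin{bmatrix} A_Q & B_Q\\ C_Q & 0\end{bmatrix}=\begin{bmatrix} Y_2 & Y_1\bar B_2\\ 0 & I\end{bmatrix}^{-1}\left(\begin{bmatrix}\hat A_Q & \hat B_Q\\ \hat C_Q & 0\end{bmatrix}-\begin{bmatrix} Y_1\bar A X_1 & 0\\ 0 & 0\end{bmatrix}\right)\begin{bmatrix} X_2^T & 0\\ \bar C_2X_1 & I\end{bmatrix}^{-1}.$$ Then the closed-loop system consisting of the augmented system and the controller $x^Q_{t+1}=A_Qx^Q_t+B_Qf_t$, $u_{f,t}=C_Qx^Q_t$ satisfies, for all mismatch functions $f_s,v_s$ obeying the sector bounds given in the context: (i) (robust stability) when $w_t\equiv 0$, the closed-loop system is asymptotically stable (at the origin); (ii) (robust performance) under zero initial conditions, $\|z\|_2<\gamma\|w\|_2$ for every nonzero disturbance $w\in\ell_2$.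
   Context: All systems are discrete-time, $t=0,1,2,\dots$; matrix inequalities $>0$, $<0$ refer to definiteness of symmetric matrices; $\|z\|_2,\|w\|_2$ for signals are $\ell_2$ norms, and $\|\cdot\|_2$ of a vector is the Euclidean norm. Plant with model mismatch: the state $\tilde x_t\in\mathbb{R}^n$, control input $u_t\in\mathbb{R}^m$, measured output $y_t\in\mathbb{R}^p$, disturbance $w_t$, performance output $z_t$ satisfy $$\tilde x_{t+1}=A\tilde x_t+B_2u_t+B_1w_t-f_s,\qquad z_t=C_1\tilde x_t+D_{12}u_t,\qquad y_t=C_2\tilde x_t-v_s,$$ with constant real matrices $A,B_1,B_2,C_1,C_2,D_{12}$, where $(A,B_2)$ is stabilizable and $(C_2,A)$ is detectable. The mismatch terms $f_s=f_s(\tilde x_t,u_t,t)\in\mathbb{R}^n$ and $v_s=v_s(\tilde x_t,u_t,t)\in\mathbb{R}^p$ are unknown functions satisfying the sector bounds, for given matrices $U_1,U_2,V_1$, $$\|f_s(\tilde x,u,t)\|_2\le\|U_1\tilde x+U_2u\|_2,\qquad \|v_s(\tilde x,u,t)\|_2\le\|V_1\tilde x\|_2\quad\text{for all }\tilde x,u,t.$$ Nominal controller: given gains $(K,L)$ forming a stabilizing observer-based controller for the nominal model $(A,B_2,C_2)$, $$\hat x_{t+1}=A\hat x_t+B_2u_t+L(\hat y_t-y_t),\quad \hat y_t=C_2\hat x_t,\quad u_{k,t}=K\hat x_t .$$ The total control is $u_t=u_{k,t}+u_{f,t}$, where $u_{f,t}$ is produced by a dynamic controller $Q$ driven by the residual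 $f_t=\hat y_t-y_t$: $$x^Q_{t+1}=A_Qx^Q_t+B_Qf_t,\qquad u_{f,t}=C_Qx^Q_t+D_Qf_t,$$ with $x^Q_t\in\mathbb{R}^{2n}$ and $D_Q=0$. Augmented system: with $e_t=\tilde x_t-\hat x_t$, $\bar x_t=\begin{bmatrix}\tilde x_t\\ e_t\end{bmatrix}\in\mathbb{R}^{2n}$ and $\bar N_t=\begin{bmatrix} f_s\\ v_s\end{bmatrix}$, the interconnection of the plant with model mismatch and the nominal observer-based controller under the total control $u_t=K\hat x_t+u_{f,t}$, viewed as a system with inputs $w_t,u_{f,t}$ and outputs $z_t,f_t$, is equivalent to $$\bar x_{t+1}=\bar A\bar x_t+\bar F\bar N_t+\bar B_1w_t+\bar B_2u_{f,t},\quad z_t=\bar C_1\bar x_t+\bar D_{12}u_{f,t},\quad f_t=\bar C_2\bar x_t+\bar D_{21}\bar N_t,$$ where $$\bar A=\begin{bmatrix}A+B_2K & -B_2K\\ 0 & A+LC_2\end{bmatrix},\ \bar F=\begin{bmatrix}-I & 0\\ -I & -L\end{bmatrix},\ \bar B_1=\begin{bmatrix}B_1\\ B_1\end{bmatrix},\ \bar B_2=\begin{bmatrix}B_2\\ 0\end{bmatrix},$$ $$\bar C_1=\begin{bmatrix}C_1+D_{12}K & -D_{12}K\end{bmatrix},\ \bar C_2=\begin{bmatrix}0 & -C_2\end{bmatrix},\ \bar D_{12}=D_{12},\ \bar D_{21}=\begin{bmatrix}0 & I\end{bmatrix}.$$ The sector bounds imply $$\|\bar N_t\|_2\le\left\|\begin{bmatrix}U'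 & U_2\\ V' & 0\end{bmatrix}\begin{bmatrix}\bar x_t\\ u_{f,t}\end{bmatrix}\right\|_2,\qquad U'=\begin{bmatrix}U_1+U_2K & -U_2K\end{bmatrix},\quad V'=\begin{bmatrix}V_1 & 0\end{bmatrix},$$ so that for the closed loop (with $D_Q=0$) the sector-bound matrix acting on $(\bar x_t,x^Q_t)$ is $U_*=\begin{bmatrix}U' & U_2C_Q\\ V' & 0\end{bmatrix}$. *)

(* Defs.v *)
From mathcomp Require Import all_boot all_order all_algebra.
From mathcomp Require Import all_classical all_reals all_analysis.
From mathcomp Require Import complex.

Set Implicit Arguments.
Unset Strict Implicit.
Unset Printing Implicit Defensive.

Import Order.TTheory GRing.Theory Num.Theory.
Import numFieldNormedType.Exports.
Local Open Scope classical_set_scope.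
Local Open Scope ring_scope.

(* The Euclidean norm: the library norm on matrices is the sup norm. *)
Definition enorm (R : realType) (k : nat) (v : 'cV[R]_k) : R :=
  Num.sqrt (\sum_(i < k) v i 0 ^+ 2).

(* Extended-real valued: +oo exactly when the signal is not in l2. *)
Definition l2norm (R : realType) (k : nat) (w : nat -> 'cV[R]_k) : \bar R :=
  ('N[counting]_2%:E [(fun t => (enorm (w t))%:E)])%E.

Definition posdef (R : realType) (k : nat) (M : 'M[R]_k) : Prop :=
  M^T = M /\ forall v : 'cV[R]_k, v != 0 -> 0 < (v^T *m M *m v) 0 0.

Definition negdef (R : realType) (k : nat) (M : 'M[R]_k) : Prop :=
  M^T = M /\ forall v : 'cV[R]_k, v != 0 -> (v^T *m M *m v) 0 0 < 0.

(* Schur stability; eigenvalues are taken over the complex numbers R[i]. *)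
Definition schur (R : realType) (k : nat) (M : 'M[R]_k) : Prop :=
  forall a : complex R, eigenvalue (map_mx (real_complex R) M) a -> `|a| < 1.

Definition stabilizable (R : realType) (n m : nat)
    (A : 'M[R]_n) (B : 'M[R]_(n, m)) : Prop :=
  exists K : 'M[R]_(m, n), schur (A + B *m K).

Definition detectable (R : realType) (n p : nat)
    (C : 'M[R]_(p, n)) (A : 'M[R]_n) : Prop :=
  exists L : 'M[R]_(n, p), schur (A + L *m C).

(* The nominal loop x+ = A x + B2 u, y = C2 x, xh+ = A xh + B2 u + L(C2 xh - y),
   u = K xh, as a linear system in (x, xh). *)
Definition stabilizing_observer_controller (R : realType) (n m p : nat)
    (A : 'M[R]_n) (B2 : 'M[R]_(n, m)) (C2 : 'M[R]_(p, n))
    (K : 'M[R]_(m, n)) (L : 'M[R]_(n, p)) : Prop :=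
  schur (block_mx A (B2 *m K)
                  (- (L *m C2)) (A + B2 *m K + L *m C2)).

Section AugmentedMatrices.
Variables (R : realType) (n m p q r k1 : nat).

Definition aug_A (A : 'M[R]_n) (B2 : 'M[R]_(n, m)) (C2 : 'M[R]_(p, n))
    (K : 'M[R]_(m, n)) (L : 'M[R]_(n, p)) : 'M[R]_(n + n) :=
  block_mx (A + B2 *m K) (- (B2 *m K)) 0 (A + L *m C2).

Definition aug_F (L : 'M[R]_(n, p)) : 'M[R]_(n + n, n + p) :=
  block_mx (- 1%:M) 0 (- 1%:M) (- L).

Definition aug_B1 (B1 : 'M[R]_(n, q)) : 'M[R]_(n + n, q) := col_mx B1 B1.

Definition aug_B2 (B2 : 'M[R]_(n, m)) : 'M[R]_(n + n, m) := col_mx B2 0.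

Definition aug_C1 (C1 : 'M[R]_(r, n)) (D12 : 'M[R]_(r, m))
    (K : 'M[R]_(m, n)) : 'M[R]_(r, n + n) :=
  row_mx (C1 + D12 *m K) (- (D12 *m K)).

Definition aug_C2 (C2 : 'M[R]_(p, n)) : 'M[R]_(p, n + n) := row_mx 0 (- C2).

Definition aug_D21 : 'M[R]_(p, n + p) := row_mx 0 1%:M.

Definition aug_U (U1 : 'M[R]_(k1, n)) (U2 : 'M[R]_(k1, m))
    (K : 'M[R]_(m, n)) : 'M[R]_(k1, n + n) :=
  row_mx (U1 + U2 *m K) (- (U2 *m K)).

Definition aug_V (V1 : 'M[R]_(k1, n)) : 'M[R]_(k1, n + n) := row_mx V1 0.

End AugmentedMatrices.

Arguments aug_D21 {R n p}.

(* Symmetric block matrix given by its upper triangle; nesting it in the last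
   argument gives the matrices whose blocks below the diagonal are starred. *)
Definition symmx (R : realType) (k l : nat) (P : 'M[R]_k) (Q : 'M[R]_(k, l))
    (S : 'M[R]_l) : 'M[R]_(k + l) :=
  block_mx P Q Q^T S.

(* N stands for the number of states 2n, s for the dimension n + p of the
   stacked mismatch, and Ah, Bh, Ch for the hatted variables. *)
Definition lmi_matrix (R : realType) (N m p q r s k1 k2 : nat) (lambda gamma : R)
    (A : 'M[R]_N) (F : 'M[R]_(N, s)) (B1 : 'M[R]_(N, q)) (B2 : 'M[R]_(N, m))
    (C1 : 'M[R]_(r, N)) (C2 : 'M[R]_(p, N)) (D12 : 'M[R]_(r, m))
    (D21 : 'M[R]_(p, s))
    (U' : 'M[R]_(k1, N)) (U2 : 'M[R]_(k1, m)) (V' : 'M[R]_(k2, N))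
    (X1 Y1 Ah : 'M[R]_N) (Bh : 'M[R]_(N, p)) (Ch : 'M[R]_(m, N)) :
    'M[R]_(N + (N + (N + (N + (s + (q + (r + (k1 + k2)))))))) :=
  symmx (- X1)
    (row_mx (- 1%:M) (row_mx (A *m X1 + B2 *m Ch) (row_mx A (row_mx F
      (row_mx B1 (row_mx 0 (row_mx 0 0))))))) (
  symmx (- Y1)
    (row_mx Ah (row_mx (Y1 *m A + Bh *m C2) (row_mx (Y1 *m F + Bh *m D21)
      (row_mx (Y1 *m B1) (row_mx 0 (row_mx 0 0)))))) (
  symmx (- X1)
    (row_mx (- 1%:M) (row_mx 0 (row_mx 0
      (row_mx (X1 *m C1^T + Ch^T *m D12^T)
        (row_mx (X1 *m U'^T + Ch^T *m U2^T) (X1 *m V'^T)))))) (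
  symmx (- Y1)
    (row_mx 0 (row_mx 0 (row_mx C1^T (row_mx U'^T V'^T)))) (
  symmx (- (lambda ^+ 2)%:M) (row_mx 0 (row_mx 0 (row_mx 0 0))) (
  symmx (- (gamma ^+ 2)%:M) (row_mx 0 (row_mx 0 0)) (
  symmx (- 1%:M) (row_mx 0 0) (
  symmx (- (1 / lambda ^+ 2)%:M) 0 (
  - (1 / lambda ^+ 2)%:M)))))))).

Definition sector_bound_f (R : realType) (n m k1 : nat)
    (U1 : 'M[R]_(k1, n)) (U2 : 'M[R]_(k1, m))
    (fs : 'cV[R]_n -> 'cV[R]_m -> nat -> 'cV[R]_n) : Prop :=
  forall x u t, enorm (fs x u t) <= enorm (U1 *m x + U2 *m u).

Definition sector_bound_v (R : realType) (n m p k2 : nat) (V1 : 'M[R]_(k2, n))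
    (vs : 'cV[R]_n -> 'cV[R]_m -> nat -> 'cV[R]_p) : Prop :=
  forall x u t, enorm (vs x u t) <= enorm (V1 *m x).

(* The state is (xbar, xQ) with xbar = (xt, e), xt the plant state and
   e = xt - xh. *)
Section ClosedLoop.
Variables (R : realType) (n m p q r : nat).
Variables (A : 'M[R]_n) (B1 : 'M[R]_(n, q)) (B2 : 'M[R]_(n, m)).
Variables (C1 : 'M[R]_(r, n)) (C2 : 'M[R]_(p, n)) (D12 : 'M[R]_(r, m)).
Variables (K : 'M[R]_(m, n)) (L : 'M[R]_(n, p)).
Variables (AQ : 'M[R]_(n + n)) (BQ : 'M[R]_(n + n, p)) (CQ : 'M[R]_(m, n + n)).
Variables (fs : 'cV[R]_n -> 'cV[R]_m -> nat -> 'cV[R]_n).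
Variables (vs : 'cV[R]_n -> 'cV[R]_m -> nat -> 'cV[R]_p).

(* The mismatch is evaluated at the plant state xt and the total control
   u = K xh + uf = K (xt - e) + uf. *)
Definition mismatch (t : nat) (xbar : 'cV[R]_(n + n)) (uf : 'cV[R]_m) :
    'cV[R]_(n + p) :=
  let xt := usubmx xbar in
  let e := dsubmx xbar in
  let u := K *m (xt - e) + uf in
  col_mx (fs xt u t) (vs xt u t).

Definition cl_step (t : nat) (w : 'cV[R]_q) (xi : 'cV[R]_((n + n) + (n + n))) :
    'cV[R]_((n + n) + (n + n)) :=
  let xbar := usubmx xi in
  let xQ := dsubmx xi in
  let uf := CQ *m xQ in
  let Nbar := mismatch t xbar uf in
  let f := aug_C2 C2 *m xbar + aug_D21 *m Nbar in
  col_mx (aug_A A B2 C2 K L *m xbar + aug_F L *m Nbar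
            + aug_B1 B1 *m w + aug_B2 B2 *m uf)
         (AQ *m xQ + BQ *m f).

Definition cl_output (xi : 'cV[R]_((n + n) + (n + n))) : 'cV[R]_r :=
  aug_C1 C1 D12 K *m usubmx xi + D12 *m (CQ *m dsubmx xi).

End ClosedLoop.

Definition trajectory_from (R : realType) (k : nat)
    (g : nat -> 'cV[R]_k -> 'cV[R]_k) (t0 : nat) (xi : nat -> 'cV[R]_k) : Prop :=
  forall t, (t0 <= t)%N -> xi t.+1 = g t (xi t).

(* Asymptotic stability of the time-varying system xi+ = g t xi: the origin is
   Lyapunov stable and every trajectory converges to it, for every initial
   time t0 (only the values of xi at times t >= t0 matter). *)
Definition asymptotically_stable (R : realType) (k : nat)
    (g : nat -> 'cV[R]_k -> 'cV[R]_k) : Prop :=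
  (forall (t0 : nat) (eps : R), 0 < eps -> exists2 delta : R, 0 < delta &
     forall xi, trajectory_from g t0 xi -> enorm (xi t0) < delta ->
       forall t, (t0 <= t)%N -> enorm (xi t) < eps) /\
  (forall (t0 : nat) xi, trajectory_from g t0 xi ->
     enorm (xi t) @[t --> \oo] --> (0 : R)).

(* Main.v *)
(* Put T = [X1 I; X2^T 0], M = [X1 I; I Y1] and h = T^-1 (xbar, xQ), and take
   V = h^T M h. In these coordinates the change of controller variables turns
   the closed loop into an equation for M h+ whose right-hand side is made of
   the first two block rows of the LMI, so evaluating the LMI at h+, h, the mismatch, the disturbance,
   the output z and lambda^2 times the sector-bound outputs gives
   V(h+) - V(h) + |z|^2 - gamma^2 |w|^2 <= - eps (|h|^2 + |w|^2), the mismatch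
   term having a favourable sign by the sector bounds. The margin eps comes from
   compactness of the unit sphere. With w = 0, V is a Lyapunov function; summing
   over time gives the strict l2 gain. *)

Require Import Defs.
From mathcomp Require Import all_boot all_order all_algebra.
From mathcomp Require Import all_classical all_reals all_analysis.
From mathcomp Require Import ssrAC ring lra.

Set Implicit Arguments.
Unset Strict Implicit.
Unset Printing Implicit Defensive.

Import Order.TTheory GRing.Theory Num.Theory.
Import numFieldNormedType.Exports.
Local Open Scope classical_set_scope.
Local Open Scope ring_scope.

(** * Euclidean inner product and block quadratic forms *)

Definition dot {R : realType} {k : nat} (u v : 'cV[R]_k) : R :=
  (u^T *m v) 0 0.

Section Dot.
Context {R : realType}.
Implicit Types k l : nat.

Lemma dotE k (u v : 'cV[R]_k) : dot u v = \sum_i u i 0 * v i 0.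
Proof. by rewrite /dot mxE; apply: eq_bigr => i _; rewrite mxE. Qed.

Lemma dotC k (u v : 'cV[R]_k) : dot u v = dot v u.
Proof. by rewrite !dotE; apply: eq_bigr => i _; rewrite mulrC. Qed.

Lemma dotDr k (u v w : 'cV[R]_k) : dot u (v + w) = dot u v + dot u w.
Proof. by rewrite /dot mulmxDr mxE. Qed.

Lemma dotNr k (u v : 'cV[R]_k) : dot u (- v) = - dot u v.
Proof. by rewrite /dot mulmxN mxE. Qed.

Lemma dotZr k c (u v : 'cV[R]_k) : dot u (c *: v) = c * dot u v.
Proof. by rewrite /dot -scalemxAr mxE. Qed.

Lemma dotZl k c (u v : 'cV[R]_k) : dot (c *: u) v = c * dot u v.
Proof. by rewrite dotC dotZr dotC. Qed.

Lemma dotDl k (u v w : 'cV[R]_k) : dot (u + v) w = dot u w + dot v w.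
Proof. by rewrite dotC dotDr !(dotC w). Qed.

Lemma dot0r k (u : 'cV[R]_k) : dot u 0 = 0.
Proof. by rewrite /dot mulmx0 mxE. Qed.

Lemma dot_mull k l (M : 'M[R]_(k, l)) u v : dot (M *m u) v = dot u (M^T *m v).
Proof. by rewrite /dot trmx_mul mulmxA. Qed.

Lemma dot_col k l (a c : 'cV[R]_k) (b d : 'cV[R]_l) :
  dot (col_mx a b) (col_mx c d) = dot a c + dot b d.
Proof. by rewrite /dot tr_col_mx mul_row_col mxE. Qed.

Lemma dot_ge0 k (u : 'cV[R]_k) : 0 <= dot u u.
Proof. by rewrite dotE sumr_ge0// => i _; rewrite -expr2 sqr_ge0. Qed.

Lemma dot_eq0 k (u : 'cV[R]_k) : (dot u u == 0) = (u == 0).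
Proof.
apply/eqP/eqP => [|->]; last exact: dot0r.
rewrite dotE => /psumr_eq0P u0; apply/matrixP => i j.
by rewrite mxE ord1; apply/eqP; rewrite -sqrf_eq0 expr2 u0// => {}i _;
   rewrite -expr2 sqr_ge0.
Qed.

Lemma enorm_sqr k (u : 'cV[R]_k) : enorm u ^+ 2 = dot u u.
Proof.
rewrite /enorm sqr_sqrtr ?sumr_ge0// => [|i _]; last exact: sqr_ge0.
by rewrite dotE; apply: eq_bigr => i _; rewrite expr2.
Qed.

Lemma enorm_ge0 k (u : 'cV[R]_k) : 0 <= enorm u.
Proof. exact: sqrtr_ge0. Qed.

(** Peels off the outermost block, so that iterating it expands the quadratic form of nested [symmx]
    matrices one block row at a time. *)
Lemma dot_symmx k l P (Q : 'M[R]_(k, l)) S x y :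
  dot (col_mx x y) (symmx P Q S *m col_mx x y) =
  dot x (P *m x) + 2 * dot x (Q *m y) + dot y (S *m y).
Proof.
rewrite /symmx mul_block_col dot_col !dotDr -(dot_mull Q).
by rewrite (dotC (Q *m y)); ring.
Qed.

Lemma posdefP k (M : 'M[R]_k) v :
  posdef M -> v != 0 -> 0 < dot v (M *m v).
Proof. by move=> [_ /(_ v)]; rewrite /dot mulmxA. Qed.

End Dot.

(** * From the LMI to a dissipation inequality *)

(** Each of the blocks [a], [z] and the scaled sector-bound outputs contributes minus its quadratic
    term on the diagonal and twice that term off the diagonal, so the term survives once with a plus
    sign. For [a] this rests on the last two equations, whose left-hand sides are the rows of
    [X1 I; I Y1] a. *)
Lemma lmi_dissipation {R : realType} {N m p q r s k1 k2 : nat} (lambda gamma : R)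
    (A : 'M[R]_N) (F : 'M[R]_(N, s)) (B1 : 'M[R]_(N, q)) (B2 : 'M[R]_(N, m))
    (C1 : 'M[R]_(r, N)) (C2 : 'M[R]_(p, N)) (D12 : 'M[R]_(r, m))
    (D21 : 'M[R]_(p, s))
    (U' : 'M[R]_(k1, N)) (U2 : 'M[R]_(k1, m)) (V' : 'M[R]_(k2, N))
    (X1 Y1 Ah : 'M[R]_N) (Bh : 'M[R]_(N, p)) (Ch : 'M[R]_(m, N))
    (eps : R) :
  0 < lambda -> 0 <= eps -> X1^T = X1 ->
  (forall v, dot v (lmi_matrix lambda gamma A F B1 B2 C1 C2 D12 D21 U' U2 V'
                  X1 Y1 Ah Bh Ch *m v) <= - eps * dot v v) ->
  forall (a1 a2 h1 h2 x : 'cV[R]_N) (u : 'cV[R]_m) (Nb : 'cV[R]_s) (w : 'cV[R]_q),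
  x = X1 *m h1 + h2 -> u = Ch *m h1 ->
  X1 *m a1 + a2 = A *m x + B2 *m u + F *m Nb + B1 *m w ->
  a1 + Y1 *m a2 = Ah *m h1 + (Y1 *m A + Bh *m C2) *m h2
    + (Y1 *m F + Bh *m D21) *m Nb + Y1 *m B1 *m w ->
  dot (col_mx a1 a2) (block_mx X1 1%:M 1%:M Y1 *m col_mx a1 a2)
    + enorm (C1 *m x + D12 *m u) ^+ 2
    + lambda ^+ 2 * (enorm (U' *m x + U2 *m u) ^+ 2 + enorm (V' *m x) ^+ 2
                     - enorm Nb ^+ 2)
  <= dot (col_mx h1 h2) (block_mx X1 1%:M 1%:M Y1 *m col_mx h1 h2)
     + gamma ^+ 2 * enorm w ^+ 2
     - eps * (enorm (col_mx h1 h2) ^+ 2 + enorm w ^+ 2).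
Proof.
move=> l0 e0 X1T lmi a1 a2 h1 h2 x u Nb w xE uE E1 E2.
have l20 : lambda ^+ 2 != 0 by rewrite expf_neq0// gt_eqF.
set z := C1 *m x + D12 *m u; set gf := U' *m x + U2 *m u; set gv := V' *m x.
pose tv := col_mx (lambda ^+ 2 *: gf) (lambda ^+ 2 *: gv).
(* No Schur complement is taken: at the first four blocks (a, h), the last three
   equal to z and lambda^2 times the sector-bound outputs, the form of the LMI
   is the dissipation expression itself. *)
have := lmi (col_mx a1 (col_mx a2 (col_mx h1 (col_mx h2 (col_mx Nb
  (col_mx w (col_mx z tv))))))).
(* The last three block columns of the LMI are adjoints of the output maps: they pair [(h1, h2)]
   with [y] as [G x + D u] does. The [V'] column is the case [D = 0]. *)
have adj k (G : 'M[R]_(k, N)) (D : 'M[R]_(k, m)) y :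
    dot h1 ((X1 *m G^T + Ch^T *m D^T) *m y) + dot h2 (G^T *m y)
    = dot (G *m x + D *m u) y.
  rewrite xE uE mulmxDl dotDr !mulmxDr !dotDl !dot_mull X1T !mulmxA.
  ring.
have adjV y : dot h1 (X1 *m V'^T *m y) + dot h2 (V'^T *m y) = dot gv y.
  by have := adj _ V' 0 y; rewrite trmx0 mulmx0 mul0mx !addr0.
have := adj _ C1 D12 z; have := adj _ U' U2 (lambda ^+ 2 *: gf).
have := adjV (lambda ^+ 2 *: gv).
rewrite -/z -/gf !dotZr; move: z gf gv @tv {adj adjV} => z gf gv tv Ev Ef Ez.
rewrite /lmi_matrix /tv !dot_symmx !mul_row_col !mul0mx !addr0 !add0r.
rewrite !dot_col !mulNmx !mul1mx !mul_scalar_mx !addrA.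
rewrite (_ : - a2 + _ + _ + _ + _ = X1 *m a1); last first.
  rewrite -[RHS](addrK a2) E1 xE uE mulmxDl mulmxDr !mulmxA [RHS]addrC !addrA.
  by congr (_ + _ + _); rewrite -!addrA; congr (_ + (_ + _)); rewrite addrC.
rewrite -E2 !enorm_sqr !dot_col !mul_block_col !dot_col !mul1mx.
have dot2 k (y : 'cV[R]_k) :
    dot (lambda ^+ 2 *: y) (- (1 / lambda ^+ 2 *: (lambda ^+ 2 *: y)))
    = - (lambda ^+ 2 * dot y y).
  by rewrite scalerA mul1r mulVf// scale1r dotNr dotZl.
rewrite !dot2 !dot0r !dotDr !dotNr ![dot _ (_ *: Nb)]dotZr ![dot _ (_ *: w)]dotZr.
rewrite (dotC a2 a1) (dotC h2 h1).
(* The margin covers every block; only its [h] and [w] parts are kept. *)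
have := dot_ge0 a1; have := dot_ge0 a2; have := dot_ge0 Nb; have := dot_ge0 z.
have := dot_ge0 (lambda ^+ 2 *: gf); have := dot_ge0 (lambda ^+ 2 *: gv).
do 6![move=> /(mulr_ge0 e0) ?]; lra.
Qed.

(** * Bounds on quadratic forms *)

Lemma continuous_quad {R : realType} k (M : 'M[R]_k) :
  continuous (fun v : 'rV[R]_k => dot v^T (M *m v^T)).
Proof.
rewrite (_ : (fun _ => _) =
  fun v : 'rV[R]_k => \sum_i v 0 i * \sum_j M i j * v 0 j); last first.
  apply/funext => v; rewrite dotE; apply: eq_bigr => i _; rewrite !mxE.
  by congr (_ * _); apply: eq_bigr => j _; rewrite mxE.
apply: (@continuous_big _ _ _ _ _ add_continuous) => i _ v.
apply: continuousM; first exact: coord_continuous.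
apply: (@continuous_big _ _ _ _ _ add_continuous) => j _ {}v.
by apply: continuousM; [exact: cst_continuous|exact: coord_continuous].
Qed.

(** The constant is the minimum over the Euclidean unit sphere, carried to all vectors by
    homogeneity of degree two. *)
Lemma quad_lower_bound {R : realType} k (M : 'M[R]_k) :
  (forall v, v != 0 -> 0 < dot v (M *m v)) ->
  exists2 c, 0 < c & forall v, c * dot v v <= dot v (M *m v).
Proof.
move=> Mpos; pose S := [set v : 'rV[R]_k | dot v^T v^T = 1].
have contdot : continuous (fun v : 'rV[R]_k => dot v^T v^T).
  by have := @continuous_quad R k 1%:M; under eq_fun do rewrite mul1mx.
have cS : compact S.
  apply: bounded_closed_compact.
    (* Boundedness refers to the sup norm: each squared coordinate is a summand of
       [dot v^T v^T = 1]. *)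
    exists 1; split => // y y1 v /= Sv; apply: le_trans (ltW y1).
    rewrite [leLHS]mx_normrE; apply: bigmax_le => //= -[i j] _ /=.
    rewrite ord1 -(@ler_pXn2r _ 2)// ?nnegrE// expr1n real_normK ?num_real//.
    rewrite -Sv dotE (bigD1 j)//= mxE -expr2 lerDl sumr_ge0// => l _.
    by rewrite -expr2 sqr_ge0.
  by move/continuous_closedP: contdot => /(_ [set y | y = 1]); apply; exact: closed_eq.
have unitS v : v != 0 ->
    exists2 u, S u^T & exists2 a, v = a *: u & a ^+ 2 = dot v v.
  move=> v0; have dv : 0 < dot v v by rewrite lt_def dot_eq0 v0 dot_ge0.
  have sq : Num.sqrt (dot v v) ^+ 2 = dot v v by rewrite sqr_sqrtr ?ltW.
  have s0 : Num.sqrt (dot v v) != 0 by rewrite gt_eqF ?sqrtr_gt0.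
  exists ((Num.sqrt (dot v v))^-1 *: v).
    by rewrite /S/= trmxK dotZl dotZr -[X in _ * (_ * X)]sq expr2 mulKf ?mulVf.
  by exists (Num.sqrt (dot v v)) => //; rewrite scalerA mulfV ?scale1r.
(* An empty sphere means that only the zero vector exists (dimension 0); the constant 1 then
   serves. *)
have [S0|/set0P S0] := eqVneq S set0.
  exists 1 => // v; have [->|/unitS[u]] := eqVneq v 0; last by rewrite S0.
  by rewrite mulmx0 !dot0r mulr0.
have [v0 /set_mem Sv0 minv0] := compact_EVT_min S0 cS
  (continuous_subspaceT (@continuous_quad R k M)).
exists (dot v0^T (M *m v0^T)) => [|v].
  apply: Mpos; apply: contraPneq Sv0 => v00.
  by rewrite /S/= v00 dot0r => /esym/eqP; rewrite oner_eq0.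
have [->|/unitS[u Su [a -> aE]]] := eqVneq v 0.
  by rewrite mulmx0 !dot0r mulr0.
move: Su (Su); rewrite {1}/S/= trmxK => uu /mem_set/minv0; rewrite trmxK => le_u.
rewrite -scalemxAr !dotZl !dotZr uu mulr1.
by have := ler_wpM2l (sqr_ge0 a) le_u; lra.
Qed.

(** Products of two coordinates are at most [dot v v], by 2ab <= a^2 + b^2. The 1 added to the sum
    of the absolute entries makes the constant positive even when [M] is zero. *)
Lemma quad_upper_bound {R : realType} k (M : 'M[R]_k) :
  exists2 c, 0 < c & forall v, dot v (M *m v) <= c * dot v v.
Proof.
exists (1 + \sum_i \sum_j `|M i j|).
  by rewrite ltr_pwDl// sumr_ge0// => i _; rewrite sumr_ge0.
move=> v; rewrite mulrDl mul1r -[leLHS]add0r lerD ?dot_ge0//.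
rewrite dotE mulr_suml ler_sum// => i _; rewrite mxE mulr_sumr mulr_suml.
rewrite ler_sum// => j _; rewrite mulrCA.
rewrite (le_trans (ler_norm _))// normrM ler_wpM2l//.
have coord l : `|v l 0| ^+ 2 <= dot v v.
  rewrite real_normK ?num_real// dotE (bigD1 l)//= -expr2 lerDl sumr_ge0// => h _.
  by rewrite -expr2 sqr_ge0.
have := coord i; have := coord j; rewrite normrM.
by have := sqr_ge0 (`|v i 0| - `|v j 0|); nra.
Qed.

(** * Lyapunov's direct method in discrete time *)

(** Telescoping the decrease bounds both the current [V] and the accumulated squared norms by the
    initial [V]. The first bound gives stability; the second gives a convergent series, whose terms
    tend to 0. *)
Lemma lyapunov_asymptotically_stable {R : realType} k
    (g : nat -> 'cV[R]_k -> 'cV[R]_k) (V : 'cV[R]_k -> R) (c1 c2 eps : R) :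
  0 < c1 -> 0 < c2 -> 0 < eps ->
  (forall x, c1 * enorm x ^+ 2 <= V x <= c2 * enorm x ^+ 2) ->
  (forall t x, V (g t x) <= V x - eps * enorm x ^+ 2) ->
  asymptotically_stable g.
Proof.
move=> c10 c20 e0 Vb Vdec.
have V0 x : 0 <= V x.
  have /andP[h _] := Vb x; apply: le_trans h.
  by rewrite mulr_ge0 ?sqr_ge0 ?ltW.
have bnd t0 xi : trajectory_from g t0 xi -> forall j,
    V (xi (t0 + j)%N) + eps * \sum_(i < j) enorm (xi (t0 + i)%N) ^+ 2 <= V (xi t0).
  move=> tr; elim=> [|j IH]; first by rewrite big_ord0 addn0 mulr0 addr0.
  rewrite big_ord_recr/= addnS tr ?leq_addr// mulrDr.
  by have := Vdec (t0 + j)%N (xi (t0 + j)%N); lra.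
have sum_ge0 (u : nat -> 'cV[R]_k) (j : nat) : 0 <= \sum_(i < j) enorm (u i) ^+ 2.
  by rewrite sumr_ge0// => i _; exact: sqr_ge0.
split=> [t0 eta eta0|t0 xi tr].
  (* This radius makes [c2 |x0|^2 < c1 eta^2], whatever the initial time. *)
  exists (eta * Num.sqrt (c1 / c2)); first by rewrite mulr_gt0 ?sqrtr_gt0 ?divr_gt0.
  move=> xi tr x0 t tt0; rewrite -(subnKC tt0).
  have := bnd _ _ tr (t - t0)%N; set y := xi (t0 + _)%N => le1.
  have := sum_ge0 (fun i => xi (t0 + i)%N) (t - t0)%N => /(mulr_ge0 (ltW e0)) s0.
  have /andP[Vy _] := Vb y; have /andP[_ Vx] := Vb (xi t0).
  rewrite -(@ltr_pXn2r _ 2)// ?nnegrE ?enorm_ge0 ?ltW//.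
  have : enorm (xi t0) ^+ 2 < eta ^+ 2 * (c1 / c2).
    rewrite -[X in _ * X]sqr_sqrtr ?divr_ge0 ?ltW// -exprMn.
    by rewrite ltr_pXn2r ?nnegrE ?enorm_ge0// ltW// mulr_gt0 ?sqrtr_gt0 ?divr_gt0.
  rewrite mulrA ltr_pdivlMr// => h.
  rewrite -(ltr_pM2l c10); lra.
have sq0 : enorm (xi (t0 + i)%N) ^+ 2 @[i --> \oo] --> (0 : R).
  apply: cvg_series_cvg_0; apply: nondecreasing_is_cvgn.
    apply/nondecreasing_seqP => j; rewrite /series/= big_nat_recr//= lerDl.
    exact: sqr_ge0.
  exists (V (xi t0) / eps) => _ [j _ <-]; rewrite /series/= ler_pdivlMr// mulrC.
  rewrite big_mkord; have := bnd _ _ tr j; have := V0 (xi (t0 + j)%N); lra.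
have : Num.sqrt (enorm (xi (t0 + i)%N) ^+ 2) @[i --> \oo] --> Num.sqrt (0 : R).
  exact: continuous_cvg _ (@sqrt_continuous R 0) sq0.
rewrite sqrtr0 [X in X @ _](_ : _ = fun i => enorm (xi (i + t0)%N)).
  by rewrite (cvg_shiftn t0 (fun t => enorm (xi t))).
by apply/funext => i; rewrite sqrtr_sqr ger0_norm ?enorm_ge0// addnC.
Qed.

(** * Strict gain from partial sums *)

Lemma l2normE {R : realType} k (w : nat -> 'cV[R]_k) :
  l2norm w = ((\sum_(t <oo) (enorm (w t) ^+ 2)%:E) `^ 2^-1)%E.
Proof.
rewrite /l2norm Lnorm_counting//; congr (_ `^ _)%E.
apply: eq_eseriesr => t _; rewrite gee0_abs ?lee_fin ?enorm_ge0//.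
by rewrite poweR_EFin powR_mulrn ?enorm_ge0.
Qed.

(** Strictness would be lost in the limit; the extra [eps] term preserves it, since the energy of
    [w] is positive and finite. *)
Lemma l2norm_lt {R : realType} k l (z : nat -> 'cV[R]_k) (w : nat -> 'cV[R]_l)
    (gamma eps : R) :
  0 < gamma -> 0 < eps -> (l2norm w < +oo)%E -> (exists t, w t != 0) ->
  (forall j, \sum_(t < j) (enorm (z t) ^+ 2 + eps * enorm (w t) ^+ 2)
       <= \sum_(t < j) gamma ^+ 2 * enorm (w t) ^+ 2) ->
  (l2norm z < gamma%:E * l2norm w)%E.
Proof.
move=> g0 e0 wfin [t0 wt0] part; move: wfin; rewrite !l2normE.
set W := (\sum_(t <oo) (enorm (w t) ^+ 2)%:E)%E.
set Z := (\sum_(t <oo) (enorm (z t) ^+ 2)%:E)%E => Wfin.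
have pos k' (u : nat -> 'cV[R]_k') (t : nat) : (0%:E <= (enorm (u t) ^+ 2)%:E)%E.
  by rewrite lee_fin sqr_ge0.
have W_lty : (W < +oo)%E by apply: lty_poweRy Wfin; rewrite gt_eqF ?invr_gt0.
have W_gt0 : (0 < W)%E.
  apply: (@lt_le_trans _ _ (\sum_(0 <= t < t0.+1) (enorm (w t) ^+ 2)%:E)%E).
    rewrite big_nat_recr//=.
    rewrite (@lt_le_trans _ _ (enorm (w t0) ^+ 2)%:E)// ?lte_fin.
      by rewrite enorm_sqr lt_def dot_eq0 wt0 dot_ge0.
    by rewrite leeDr// sume_ge0.
  by apply: nneseries_lim_ge => t _ _; exact: pos.
have Z0 : (0 <= Z)%E by apply: nneseries_ge0 => t _ _; exact: pos.
have ZW : (Z + eps%:E * W <= (gamma ^+ 2)%:E * W)%E.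
  rewrite -!nneseriesZl//; try by move=> *; exact: pos.
  rewrite -nneseriesD//; try by move=> *; rewrite ?mule_ge0 ?pos ?lee_fin ?ltW.
  apply: lee_lim.
  - by apply: is_cvg_nneseries => t _ _; rewrite adde_ge0 ?mule_ge0 ?pos ?lee_fin ?ltW.
  - by apply: is_cvg_nneseries => t _ _; rewrite ?mule_ge0 ?pos ?lee_fin ?sqr_ge0.
  - apply: nearW => j; have := part j; rewrite -lee_fin !big_mkord.
    by rewrite !sumEFin.
move: W_lty W_gt0 Z0 ZW; clearbody W Z.
(* With [W] finite, [ZW] excludes an infinite [Z]: the output is shown to be in l2 here. *)
case: W {Wfin} => [W| |]//; case: Z => [Z| |]// _.
rewrite !lte_fin lee_fin => W0 Z0; rewrite lee_fin => ZW.
rewrite !powR12_sqrt ?(ltW W0)//.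
rewrite -[X in X * _](@ger0_norm _ gamma) ?(ltW g0)// -sqrtr_sqr -sqrtrM ?sqr_ge0//.
by rewrite ltr_sqrt ?mulr_gt0 ?exprn_gt0//; have := mulr_gt0 e0 W0; lra.
Qed.

(** * Change of controller variables *)

(** The outer factors are block triangular with invertible diagonal blocks, so multiplying back by
    them solves for the hatted variables. *)
Lemma hatted_variablesE {R : realType} N m p (A X1 Y1 X2 Y2 Ah AQ : 'M[R]_N)
    (B2 : 'M[R]_(N, m)) (C2 : 'M[R]_(p, N)) (Bh BQ : 'M[R]_(N, p))
    (Ch CQ : 'M[R]_(m, N)) :
  X2 \in unitmx -> Y2 \in unitmx ->
  block_mx AQ BQ CQ 0 =
     invmx (block_mx Y2 (Y1 *m B2) 0 1%:M)
     *m (block_mx Ah Bh Ch 0 - block_mx (Y1 *m A *m X1) 0 0 0)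
     *m invmx (block_mx X2^T 0 (C2 *m X1) 1%:M) ->
  [/\ Ah = Y1 *m A *m X1 + Y1 *m B2 *m Ch + Bh *m C2 *m X1 + Y2 *m AQ *m X2^T,
      Bh = Y2 *m BQ & Ch = CQ *m X2^T].
Proof.
move=> X2u Y2u; set G := block_mx Y2 _ _ _; set H := block_mx X2^T _ _ _.
have Gu : G \in unitmx by rewrite unitmxE det_ublock det1 mulr1 -unitmxE.
have Hu : H \in unitmx by rewrite unitmxE det_lblock det1 mulr1 det_tr -unitmxE.
move=> /(congr1 (fun Q => G *m Q *m H)).
rewrite -!mulmxA mulVmx// mulmx1 !mulmxA mulmxV// mul1mx /G /H.
rewrite !mulmx_block opp_block_mx add_block_mx.
rewrite !mul0mx !mulmx0 !mulmx1 !mul1mx !subr0 !add0r !mul0mx !addr0 mulmxDl.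
move=> /eq_block_mx [hA <- <- _]; split=> //.
rewrite -[LHS](subrK (Y1 *m A *m X1)) -hA !mulmxA.
by rewrite [LHS](ACl (4*2*3*1)).
Qed.

(** * Dissipation along the closed loop *)

Section Dissipation.
Variables (R : realType) (n m p q r k1 k2 : nat).
Variables (A : 'M[R]_n) (B1 : 'M[R]_(n, q)) (B2 : 'M[R]_(n, m)).
Variables (C1 : 'M[R]_(r, n)) (C2 : 'M[R]_(p, n)) (D12 : 'M[R]_(r, m)).
Variables (K : 'M[R]_(m, n)) (L : 'M[R]_(n, p)).
Variables (U1 : 'M[R]_(k1, n)) (U2 : 'M[R]_(k1, m)) (V1 : 'M[R]_(k2, n)).

(** In terms of the total control [v = K (xt - e) + u], the augmented output [U' x + U2 u] is just
    [U1 xt + U2 v], and [V' x] is [V1 xt]. *)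
Lemma sector_mismatch fs vs t (x : 'cV[R]_(n + n)) (u : 'cV[R]_m) :
  sector_bound_f U1 U2 fs -> sector_bound_v V1 vs ->
  enorm (mismatch (p := p) K fs vs t x u) ^+ 2 <=
  enorm (aug_U U1 U2 K *m x + U2 *m u) ^+ 2 + enorm (aug_V V1 *m x) ^+ 2.
Proof.
move=> hf hv; rewrite /mismatch enorm_sqr dot_col -!enorm_sqr.
set xt := usubmx x; set e := dsubmx x; set v := _ + u.
have -> : x = col_mx xt e by rewrite vsubmxK.
rewrite /aug_U /aug_V !mul_row_col mul0mx addr0.
rewrite (_ : _ + U2 *m u = U1 *m xt + U2 *m v).
  by rewrite lerD// ler_pXn2r ?nnegrE ?enorm_ge0.
rewrite /v mulmxDl mulNmx !mulmxDr !mulmxN -!mulmxA.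
by rewrite !addrA.
Qed.


Variables (lambda gamma : R).
Variables (X1 Y1 X2 Y2 Ah : 'M[R]_(n + n)) (Bh : 'M[R]_(n + n, p)).
Variables (Ch : 'M[R]_(m, n + n)).
Variables (AQ : 'M[R]_(n + n)) (BQ : 'M[R]_(n + n, p)) (CQ : 'M[R]_(m, n + n)).

Lemma closed_loop_dissipation fs vs :
  0 < lambda -> posdef X1 -> posdef (block_mx X1 1%:M 1%:M Y1) ->
  negdef (lmi_matrix lambda gamma
     (aug_A A B2 C2 K L) (aug_F L) (aug_B1 B1) (aug_B2 B2)
     (aug_C1 C1 D12 K) (aug_C2 C2) D12 aug_D21
     (aug_U U1 U2 K) U2 (aug_V V1) X1 Y1 Ah Bh Ch) ->
  X2 \in unitmx -> Y2 \in unitmx -> Y1 *m X1 + Y2 *m X2^T = 1%:M ->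
  block_mx AQ BQ CQ 0 =
     invmx (block_mx Y2 (Y1 *m aug_B2 B2) 0 1%:M)
     *m (block_mx Ah Bh Ch 0 - block_mx (Y1 *m aug_A A B2 C2 K L *m X1) 0 0 0)
     *m invmx (block_mx X2^T 0 (aug_C2 C2 *m X1) 1%:M) ->
  sector_bound_f U1 U2 fs -> sector_bound_v V1 vs ->
  exists (V : 'cV[R]_((n + n) + (n + n)) -> R) (c1 c2 eps : R),
  [/\ 0 < c1, 0 < c2, 0 < eps,
    forall xi, c1 * enorm xi ^+ 2 <= V xi <= c2 * enorm xi ^+ 2 &
    forall t w xi,
      V (cl_step A B1 B2 C2 K L AQ BQ CQ fs vs t w xi)
        + enorm (cl_output C1 D12 K CQ xi) ^+ 2
      <= V xi + gamma ^+ 2 * enorm w ^+ 2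
         - eps * (enorm xi ^+ 2 + enorm w ^+ 2)].
Proof.
move=> l0 X1p Mp [_ lmi] X2u Y2u XY hQ hf hv.
have [hA hB hC] := hatted_variablesE X2u Y2u hQ.
set M := block_mx X1 _ _ _ in Mp *.
set W := lmi_matrix _ _ _ _ _ _ _ _ _ _ _ _ _ _ _ _ _ _ in lmi.
have [e0 e0_gt0 lmi_e0] :
    exists2 c, 0 < c & forall v, c * dot v v <= dot v (- W *m v).
  apply: quad_lower_bound => v /lmi; rewrite -mulmxA -/(dot v _) => v0.
  by rewrite mulNmx dotNr oppr_gt0.
have [cM cM0 hcM] := quad_lower_bound (fun v => @posdefP _ _ _ v Mp).
(* T^-T M T^-1 is the closed-loop Lyapunov matrix: its upper blocks are Y1, Y2. *)
pose T : 'M[R]_((n + n) + (n + n)) := block_mx X1 1%:M X2^T 0.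
(* Solves [x = X1 h1 + h2], [xQ = X2^T h1] for [(h1, h2)]. *)
pose Ti : 'M[R]_((n + n) + (n + n)) :=
  block_mx 0 (invmx X2^T) 1%:M (- (X1 *m invmx X2^T)).
have X2Tu : X2^T \in unitmx by rewrite unitmx_tr.
have TTi : T *m Ti = 1%:M.
  rewrite /T /Ti mulmx_block !mulmx0 mulmxV// !mul0mx !addr0 add0r !mul1mx subrr.
  by rewrite -scalar_mx_block.
pose eta xi : 'cV[R]_((n + n) + (n + n)) := Ti *m xi.
have etaE xi :
    col_mx (X1 *m usubmx (eta xi) + dsubmx (eta xi))
           (X2^T *m usubmx (eta xi)) = xi.
  rewrite -[RHS]mul1mx -TTi -mulmxA -/(eta xi) -[in RHS](vsubmxK (eta xi)).
  rewrite mul_block_col.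
  by rewrite mul1mx mul0mx addr0.
have etaU xi : X1 *m usubmx (eta xi) + dsubmx (eta xi) = usubmx xi.
  by rewrite -[in RHS](etaE xi) col_mxKu.
have etaD xi : X2^T *m usubmx (eta xi) = dsubmx xi.
  by rewrite -[in RHS](etaE xi) col_mxKd.
have [cT cT0 hcT] := quad_upper_bound (T^T *m T).
have [cV cV0 hcV] := quad_upper_bound (Ti^T *m M *m Ti).
(* The added 1 gives [e0 / (1 + cT) <= e0], so that one margin also serves the disturbance term
   below. *)
have norm_eta xi : enorm xi ^+ 2 <= (1 + cT) * enorm (eta xi) ^+ 2.
  rewrite !enorm_sqr mulrDl mul1r (le_trans _ (lerD (dot_ge0 _) (hcT _)))//.
  by rewrite add0r -mulmxA -dot_mull mulmxA TTi mul1mx.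
have cT1 : 0 < 1 + cT by lra.
exists (fun xi => dot (eta xi) (M *m eta xi)).
exists (cM / (1 + cT)), cV, (e0 / (1 + cT)); split; rewrite ?divr_gt0//.
- move=> xi; apply/andP; split.
    rewrite (le_trans _ (hcM _))// -mulrA ler_pM2l// mulrC ler_pdivrMr// mulrC.
    by rewrite -enorm_sqr.
  by rewrite enorm_sqr (le_trans _ (hcV _))// /eta dot_mull !mulmxA.
move=> t w xi.
set x := usubmx xi; set xQ := dsubmx xi.
set xi' := cl_step _ _ _ _ _ _ _ _ _ _ _ _ _ _.
pose u := CQ *m xQ; pose Nb := mismatch K fs vs t x u.
have xE : x = X1 *m usubmx (eta xi) + dsubmx (eta xi) by rewrite etaU.
have xQE : xQ = X2^T *m usubmx (eta xi) by rewrite etaD.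
have uE : u = Ch *m usubmx (eta xi) by rewrite /u xQE hC mulmxA.
have E1 : X1 *m usubmx (eta xi') + dsubmx (eta xi') =
  aug_A A B2 C2 K L *m x + aug_B2 B2 *m u + aug_F L *m Nb + aug_B1 B1 *m w.
  by rewrite etaU /xi' /cl_step col_mxKu [LHS](ACl (1*4*2*3)).
(* Inserting [Y1 X1 + Y2 X2^T = I] in front of h1' turns the left-hand side into
   [Y1 xbar' + Y2 xQ']; the closed-loop equations and the hatted variables then give the second
   block row of the LMI. *)
have E2 : usubmx (eta xi') + Y1 *m dsubmx (eta xi') =
   Ah *m usubmx (eta xi)
   + (Y1 *m aug_A A B2 C2 K L + Bh *m aug_C2 C2) *m dsubmx (eta xi)
   + (Y1 *m aug_F L + Bh *m aug_D21) *m Nb + Y1 *m aug_B1 B1 *m w.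
  rewrite -[X in X + _ = _]mul1mx -XY mulmxDl addrAC -!mulmxA -mulmxDr.
  rewrite etaU etaD.
  rewrite /xi' /cl_step col_mxKu col_mxKd -/x -/xQ -/u -/Nb.
  rewrite xQE xE uE hA hB !(mulmxDl, mulmxDr, mulmxA).
  by rewrite !addrA [LHS](ACl (1*5*7*6*2*8*3*9*4)).
have lmi_e0' v : dot v (W *m v) <= - e0 * dot v v.
  by have := lmi_e0 v; rewrite mulNmx dotNr; lra.
have X1T : X1^T = X1 by case: X1p.
have := lmi_dissipation l0 (ltW e0_gt0) X1T lmi_e0' xE uE E1 E2.
have hs := sector_mismatch t x u hf hv.
rewrite !vsubmxK -/M => diss.
have : 0 <= lambda ^+ 2 * (enorm (aug_U U1 U2 K *m x + U2 *m u) ^+ 2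
   + enorm (aug_V V1 *m x) ^+ 2 - enorm Nb ^+ 2).
  by rewrite mulr_ge0 ?sqr_ge0// subr_ge0.
have : e0 / (1 + cT) * enorm xi ^+ 2 <= e0 * enorm (eta xi) ^+ 2.
  by rewrite -mulrA ler_pM2l// mulrC ler_pdivrMr// mulrC.
have : e0 / (1 + cT) * enorm w ^+ 2 <= e0 * enorm w ^+ 2.
  rewrite ler_wpM2r ?sqr_ge0// ler_pdivrMr// ler_peMr ?ltW//; lra.
by rewrite /cl_output -/x -/xQ -/u; lra.
Qed.

End Dissipation.

(** * Robust stability and robust performance *)

Theorem theorem2 (R : realType) (n m p q r k1 k2 : nat)
  (A : 'M[R]_n) (B1 : 'M[R]_(n, q)) (B2 : 'M[R]_(n, m))
  (C1 : 'M[R]_(r, n)) (C2 : 'M[R]_(p, n)) (D12 : 'M[R]_(r, m))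
  (K : 'M[R]_(m, n)) (L : 'M[R]_(n, p))
  (U1 : 'M[R]_(k1, n)) (U2 : 'M[R]_(k1, m)) (V1 : 'M[R]_(k2, n))
  (lambda gamma : R)
  (X1 Y1 X2 Y2 Ah : 'M[R]_(n + n)) (Bh : 'M[R]_(n + n, p)) (Ch : 'M[R]_(m, n + n))
  (AQ : 'M[R]_(n + n)) (BQ : 'M[R]_(n + n, p)) (CQ : 'M[R]_(m, n + n))
  (hstab : stabilizable A B2) (hdet : detectable C2 A)
  (hKL : stabilizing_observer_controller A B2 C2 K L)
  (hlambda : 0 < lambda) (hgamma : 0 < gamma)
  (hX1 : posdef X1) (hY1 : posdef Y1)
  (hXY : posdef (block_mx X1 1%:M 1%:M Y1))
  (hlmi : negdef (lmi_matrix lambda gamma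
     (aug_A A B2 C2 K L) (aug_F L) (aug_B1 B1) (aug_B2 B2)
     (aug_C1 C1 D12 K) (aug_C2 C2) D12 aug_D21
     (aug_U U1 U2 K) U2 (aug_V V1) X1 Y1 Ah Bh Ch))
  (hX2 : X2 \in unitmx) (hY2 : Y2 \in unitmx)
  (hXY2 : Y1 *m X1 + Y2 *m X2^T = 1%:M)
  (hQ : block_mx AQ BQ CQ 0 =
     invmx (block_mx Y2 (Y1 *m aug_B2 B2) 0 1%:M)
     *m (block_mx Ah Bh Ch 0 - block_mx (Y1 *m aug_A A B2 C2 K L *m X1) 0 0 0)
     *m invmx (block_mx X2^T 0 (aug_C2 C2 *m X1) 1%:M)) :
  forall (fs : 'cV[R]_n -> 'cV[R]_m -> nat -> 'cV[R]_n)
         (vs : 'cV[R]_n -> 'cV[R]_m -> nat -> 'cV[R]_p),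
  sector_bound_f U1 U2 fs -> sector_bound_v V1 vs ->
  let step := cl_step A B1 B2 C2 K L AQ BQ CQ fs vs in
  let out := cl_output C1 D12 K CQ in
  asymptotically_stable (fun t xi => step t 0 xi) /\
  (forall (w : nat -> 'cV[R]_q) (xi : nat -> 'cV[R]_((n + n) + (n + n))),
     (l2norm w < +oo)%E -> (exists t, w t != 0) ->
     xi 0%N = 0 -> (forall t, xi t.+1 = step t (w t) (xi t)) ->
     (l2norm (fun t => out (xi t)) < gamma%:E * l2norm w)%E).
Proof.
move=> fs vs hf hv step out.
have [V [c1 [c2 [eps [c1_gt0 c2_gt0 eps_gt0 Vb diss]]]]] :=
  closed_loop_dissipation hlambda hX1 hXY hlmi hX2 hY2 hXY2 hQ hf hv.
split=> [|w xi wfin wn0 xi0 tr].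
  apply: (lyapunov_asymptotically_stable c1_gt0 c2_gt0 eps_gt0 Vb) => t x.
  have := diss t 0 x; have := sqr_ge0 (enorm (cl_output C1 D12 K CQ x)).
  by rewrite [enorm 0 ^+ 2]enorm_sqr dot0r /step; lra.
apply: (l2norm_lt hgamma eps_gt0 wfin wn0) => j.
have V_ge0 x : 0 <= V x.
  have /andP[c1V _] := Vb x; apply: le_trans c1V.
  by rewrite mulr_ge0 ?sqr_ge0 ?ltW.
have V0 : V 0 <= 0 by have := Vb 0; rewrite enorm_sqr dot0r !mulr0 => /andP[].
(* Keeping the storage [V (xi j)] on the left lets the induction telescope; it starts from
   [V 0 <= 0] and the storage is finally dropped by nonnegativity. *)
suff : V (xi j) + \sum_(t < j) (enorm (out (xi t)) ^+ 2 + eps * enorm (w t) ^+ 2)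
    <= \sum_(t < j) gamma ^+ 2 * enorm (w t) ^+ 2 by have := V_ge0 (xi j); lra.
elim: j => [|j IH]; first by rewrite !big_ord0 addr0 xi0.
rewrite !big_ord_recr/= tr.
have := diss j (w j) (xi j); have := mulr_ge0 (ltW eps_gt0) (sqr_ge0 (enorm (xi j))).
by rewrite -/step -/out; lra.
Qed.
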